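(* Suppose that the random walk on a growing graph $\mathcal D=(\mathfrak d,G,P)$, started at $v\in V(1)$, is LHaGG (less-homesick as graph growing), and that every $P(n)=P_n$ ($n=1,2,\dots$) is irreducible and reversible with period $2$. Let $p(n)=\mathring\pi_n(v)$, where $\mathring\pi_n$ denotes the even-time stationary distribution of $P_n$. Let $\mathring\tau_n(\epsilon)$ denote the even mixing-time of $P_n$, and let $\mathring{\mathfrak t}(n)=\mathring\tau_n(p(n))$ for $n=1,2,3,\dots$. If $$\max\{\mathfrak d(1),\mathring{\mathfrak t}(1)\}+\sum_{n=2}^\infty\max\{\mathfrak d(n),\mathring{\mathfrak t}(n)\}\,p(n-1)<\infty,$$ then $v$ is transient by $\mathcal D$.
   Context: Random walk on a growing graph (RWoGG). A RWoGG is a triple $\mathcal D=(\mathfrak d,G,P)$, where $\mathfrak d:\mathbb Z_{>0}\to\mathbb Z_{\ge0}$ (the duration), $G(n)=(V(n),E(n))$ is a finite simple undirected graph for each $n\ge1$ with $V(n)\subseteq V(n+1)$, $E(n)\subseteq E(n+1)$ and $|\bigcup_nV(n)|=\infty$, and $P(n)$ is a stochastic matrix on $V(n)$ describing a random walk on $G(n)$ (so $P(n)(u,w)>0$ only if $u=w$ or $\{u,w\}\in E(n)$). Put $T_0=0$ and $T_n=\sum_{i=1}^n\mathfrak d(i)$; it is assumed that $T_n\to\infty$, so that the walk is defined at all times. The walk $X_0,X_1,\dots$ started at $v\in V(1)$ is the Markov process with $X_0=v$ in which the transition from $X_t$ to $X_{t+1}$ follows $P(n)$ whenever $T_{n-1}\le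 t<T_n$. Let $R(t)=\Pr[X_t=v]$. The vertex $v$ is recurrent by $\mathcal D$ if $\sum_{t=1}^\infty R(t)=\infty$, and transient otherwise. LHaGG. Fix $G$, $P$ and the initial vertex $v$; for a duration function $f$ let $R_f(t)$ be the return probability at time $t$ for $(f,G,P)$. The walk $(\mathfrak d,G,P)$ is LHaGG if the sequence $(G(n),P(n))_{n\ge1}$ has the following property: for all duration functions $f,g$ with $\sum_{i=1}^nf(i)\le\sum_{i=1}^ng(i)$ for every $n\ge1$, one has $R_f(t)\le R_g(t)$ for every $t\ge1$. (It is a property of the sequence, not of the particular $\mathfrak d$.) Even-time notions. If a stochastic matrix $P$ on a finite set $V$ is irreducible, reversible (there is $\mu:V\to\mathbb R_{>0}$ with $\mu(u)P(u,w)=\mu(w)P(w,u)$ for all $u,w$) and has period $2$, let $U=\{u\in V:\exists t',\ P^{2t'}(v,u)\ne0\}$, where $v$ is the initial vertex. The even-time stationary distribution $\mathring\pi$ of $P$ is the unique probability distribution on $V$ vanishing outside $U$ with $\mathring\pi P^2=\mathring\pi$. The even mixing-time of $P$ is $$\mathring\tau(\epsilon)=\min\Big\{2t' : t'\in\mathbb Z_{>0},\ \tfrac12\max_{u\in U}\sum_{w\in U}|P^{2t'}(u,w)-\mathring\pi(w)|\le\epsilon\Big\}$$ for $\epsilon\in(0,1]$. *)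

(* Defs.v *)
From HB Require Import structures.
From mathcomp Require Import all_boot all_order all_algebra finmap.
From mathcomp Require Import all_classical all_reals all_analysis.

Set Implicit Arguments.
Unset Strict Implicit.
Unset Printing Implicit Defensive.

Import Order.TTheory GRing.Theory Num.Theory.

Local Open Scope classical_set_scope.
Local Open Scope ring_scope.

(* Conventions.  Phases are numbered from 1, so the value at 0 of a sequence
   indexed by phases (duration, vertex sets, edges, matrices) is never used.
   All vertices live in one ambient type [T].  A matrix on a finite vertex set
   [V] is a function [T -> T -> R] whose entries outside [V * V] are zero. *)

Section Matrices.
Variables (R : realType) (T : choiceType).
Implicit Types (V : {fset T}) (P : T -> T -> R) (v : T) (pi : T -> R).

Definition stochastic_on V P : Prop :=
  [/\ forall u w, 0 <= P u w,
      forall u w, P u w != 0 -> u \in V /\ w \in V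
    & forall u, u \in V -> \sum_(w <- V) P u w = 1].

Fixpoint mpow V P (k : nat) : T -> T -> R :=
  if k is k'.+1 then fun u w => \sum_(z <- V) P u z * mpow V P k' z w
  else fun u w => ((u == w) && (u \in V))%:R.

Definition irreducible V P : Prop :=
  forall u w, u \in V -> w \in V -> exists k, mpow V P k u w != 0.

Definition reversible V P : Prop :=
  exists mu : T -> R, (forall u, u \in V -> 0 < mu u) /\
    (forall u w, u \in V -> w \in V -> mu u * P u w = mu w * P w u).

(* [c] is the gcd of the (possibly infinite) set of return times of each [u],
   the gcd being given by its universal property. *)
Definition has_period V P (c : nat) : Prop :=
  forall u, u \in V -> forall m : nat,
    (m %| c)%N <->
    (forall k, (0 < k)%N -> mpow V P k u u != 0 -> (m %| k)%N).

Definition even_class V P v : {fset T} :=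
  [fset u in V | `[< exists t', mpow V P (2 * t') v u != 0 >]]%fset.

Definition even_stationary V P v pi : Prop :=
  [/\ forall u, 0 <= pi u,
      forall u, u \notin even_class V P v -> pi u = 0,
      \sum_(u <- V) pi u = 1
    & forall w, w \in V -> \sum_(u <- V) pi u * mpow V P 2 u w = pi w].

Definition even_pi V P v : T -> R :=
  xget (fun=> 0) [set pi | even_stationary V P v pi].

(* The summands are nonnegative and the even class contains [v], so that 0 is
   harmless as the neutral element of the maximum. *)
Definition even_distance V P v (s : nat) : R :=
  2^-1 * \big[Num.max/0]_(u <- even_class V P v)
           \sum_(w <- even_class V P v) `|mpow V P s u w - even_pi V P v w|.

(* The minimum is taken in the extended reals: it is the infimum of a set of
   natural numbers, which would be +oo if that set were empty. *)
Definition even_mixing_time V P v (eps : R) : \bar R :=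
  ereal_inf [set (2 * t')%N%:R%:E |
             t' in [set t' | (0 < t')%N /\ even_distance V P v (2 * t') <= eps]].

End Matrices.

Definition elapsed (f : nat -> nat) (n : nat) : nat :=
  (\sum_(1 <= i < n.+1) f i)%N.

Definition duration_function (f : nat -> nat) : Prop :=
  elapsed f n @[n --> \oo] --> \oo.

Definition phase (f : nat -> nat) (t : nat) : nat :=
  xget 1%N
    [set n : nat | (0 < n)%N /\ (elapsed f n.-1 <= t < elapsed f n)%N].

Section Walks.
Variables (R : realType) (T : choiceType).
Implicit Types (f : nat -> nat) (V : nat -> {fset T}) (E : nat -> rel T).
Implicit Types (P : nat -> T -> T -> R) (v : T).

Definition growing_graph V E : Prop :=
  [/\ forall n, (0 < n)%N ->
        [/\ symmetric (E n), irreflexive (E n)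
          & forall u w, E n u w -> u \in V n /\ w \in V n],
      forall n, (0 < n)%N -> (V n `<=` V n.+1)%fset,
      forall n, (0 < n)%N -> forall u w, E n u w -> E n.+1 u w
    & infinite_set (\bigcup_(n in [set n | (0 < n)%N]) [set` V n])].

Definition walk_on V E P : Prop :=
  forall n, (0 < n)%N ->
    stochastic_on (V n) (P n) /\
    (forall u w, 0 < P n u w -> u = w \/ E n u w).

Definition rwogg f V E P : Prop :=
  [/\ duration_function f, growing_graph V E & walk_on V E P].

(* [walk_law f V P v t w] is Pr[X_t = w], computed by the one-step equation of
   the time-inhomogeneous Markov chain; see [walk_lawP] below. *)
Fixpoint walk_law f V P v (t : nat) : T -> R :=
  if t is t'.+1 then fun w =>
    let n := phase f t' in \sum_(u <- V n) walk_law f V P v t' u * P n u w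
  else fun w => (w == v)%:R.

Definition return_prob f V P v (t : nat) : R := walk_law f V P v t v.

Definition recurrent f V P v : Prop :=
  (\sum_(1 <= t <oo) (return_prob f V P v t)%:E = +oo)%E.

Definition transient f V P v : Prop := ~ recurrent f V P v.

Definition lhagg V P v : Prop :=
  forall f g, duration_function f -> duration_function g ->
    (forall n, (0 < n)%N -> (elapsed f n <= elapsed g n)%N) ->
    forall t, (0 < t)%N -> return_prob f V P v t <= return_prob g V P v t.

(* The walk as a stochastic process, Markov with respect to its natural
   filtration. *)
Definition markov_walk f V P v (disp : measure_display)
    (Omega : measurableType disp) (Pr : probability Omega R)
    (X : nat -> Omega -> T) : Prop :=
  [/\ forall t x, measurable (X t @^-1` [set x]),
      forall t om, X t om \in V (phase f t),
      forall om, X 0%N om = v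
    & forall t (A : set Omega),
        <<s [set B | exists s x, (s <= t)%N /\ B = X s @^-1` [set x]] >> A ->
        forall u w, u \in V (phase f t) ->
        Pr (A `&` X t @^-1` [set u] `&` X t.+1 @^-1` [set w]) =
        (Pr (A `&` X t @^-1` [set u]) * (P (phase f t) u w)%:E)%E].

Lemma walk_lawP f V P v (disp : measure_display)
    (Omega : measurableType disp) (Pr : probability Omega R)
    (X : nat -> Omega -> T) :
  markov_walk f V P v Pr X ->
  forall t w, Pr (X t @^-1` [set w]) = (walk_law f V P v t w)%:E.
Proof.
case=> mX XV X0 XM; elim=> [|t IHt] w.
  rewrite /=; have [->|wv] := eqVneq w v.
    have -> : X 0%N @^-1` [set v] = setT by apply/seteqP; split=> // om _; exact: X0.
    exact: probability_setT.
  have -> : X 0%N @^-1` [set w] = set0.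
    apply/seteqP; split=> // om /=; rewrite X0 => vw.
    by rewrite vw eqxx in wv.
  exact: measure0.
have -> : X t.+1 @^-1` [set w] = \bigcup_(u in [set` V (phase f t)])
    (X t @^-1` [set u] `&` X t.+1 @^-1` [set w]).
  apply/seteqP; split=> [om Xw|om [u _ []]//].
  by exists (X t om); [exact: XV|split].
rewrite bigcup_fset measure_fbigsetU /=; last 2 first.
- by move=> u _; apply: measurableI; exact: mX.
- by move=> u u' _ _ [om [[/= <- _] [/= <- _]]].
rewrite -sumEFin; apply: eq_big_seq => u uV.
have AT : <<s [set B | exists s x, (s <= t)%N /\ B = X s @^-1` [set x]] >> setT.
  rewrite -[X in _ X](setD0 setT).
  by apply: sigma_algebraCD; apply: sigma_algebra0.
by have := XM t setT AT u w uV; rewrite !setTI => ->; rewrite IHt EFinM.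
Qed.

End Walks.

(* Main.v *)
Require Import Defs.
From HB Require Import structures.
From mathcomp Require Import all_boot all_order all_algebra finmap.
From mathcomp Require Import all_classical all_reals all_analysis.
From mathcomp Require Import zify lra.

Set Implicit Arguments.
Unset Strict Implicit.
Unset Printing Implicit Defensive.

Import Order.TTheory GRing.Theory Num.Theory.

Local Open Scope classical_set_scope.
Local Open Scope ring_scope.

(** Longer phases can only increase return probabilities, so [d] may be replaced
    by [g n], the maximum of [d n] and the even mixing time of [P n].  Let a time
    [t] come after the end of phase [k] of the [g]-walk.  By the less-homesick
    property again, the return probability at [t] is at most that of the walk
    whose phase [k] is prolonged beyond [t].  In the latter, [P k] has been
    applied for at least one mixing time when [t] is reached, whatever the
    position at the start of phase [k]; hence the return probability is at most
    [3 * p k] ([return_prob_after_phase], [mpow_even_mixed]).  Applying this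
    with [k = n - 1] to each time of phase [n] of the [g]-walk, and bounding by
    1 during the first phase, yields ([sum_phases_le])
      [sum_t R(t) <= g 1 + 3 * sum_(n >= 2) g n * p (n - 1) < oo].

    Parity is dealt with by two observations.  A vertex outside the even class
    of [v] cannot reach [v] at an even time, so at the mixing time the bound
    [3 * p k] holds for the whole column of [v] in the matrix power.  And the
    maximum of that column is nonincreasing in the exponent ([mpow_col_le]), so
    the bound persists at all later times, odd ones included.

    The constant 3 arises as follows: total variation distance at most [p k]
    bounds the l1 distance to the even-time stationary distribution by
    [2 * p k], and the stationary mass at [v] is [p k]. *)

(** * Powers of a stochastic matrix *)

Lemma ler_term_sum (R : numDomainType) (I : eqType) (r : seq I) (F : I -> R)
    (x : I) :
  (forall y, 0 <= F y) -> x \in r -> F x <= \sum_(y <- r) F y.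
Proof.
by move=> F0 xr; rewrite (big_rem x)//= lerDl; apply: sumr_ge0 => y _.
Qed.

Lemma sum_delta (R : pzRingType) (T : choiceType) (V : {fset T}) (u : T)
    (F : T -> R) :
  u \in V -> \sum_(w <- V) (u == w)%:R * F w = F u.
Proof.
move=> uV; rewrite (big_rem u)//= eqxx mul1r big_seq big1 ?addr0// => w.
by rewrite mem_rem_uniq ?fset_uniq// inE eq_sym => /andP[/negPf-> _]; rewrite mul0r.
Qed.

Section StochasticMatrix.
Variables (R : realType) (T : choiceType) (V : {fset T}) (P : T -> T -> R).
Hypothesis stochP : stochastic_on V P.

Lemma stochastic_ge0 u w : 0 <= P u w.
Proof. by case: stochP. Qed.

Lemma stochastic_eq0 u w : u \notin V \/ w \notin V -> P u w = 0.
Proof.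
case: stochP => _ supp _ uw; apply/eqP/negP => /negP/supp[uV wV].
by case: uw; rewrite ?uV ?wV.
Qed.

(** [A] is arbitrary because the mass of the law after a step of one phase is
    measured on the vertex set of another. *)
Lemma stochastic_sum_le1 (A : {fset T}) u : \sum_(w <- A) P u w <= 1.
Proof.
have [uV|uV] := boolP (u \in V); last first.
  by rewrite big1 ?ler01// => w _; apply: stochastic_eq0; left.
have [_ _ /(_ u uV) <-] := stochP.
rewrite [leRHS](big_fset_incl _ (fsubsetUr A V)); last first.
  by move=> w _ wV; apply: stochastic_eq0; right.
have -> : \sum_(w <- A) P u w = \sum_(w <- A) (w \in A)%:R * P u w.
  by apply: eq_big_seq => w ->; rewrite mul1r.
rewrite (big_fset_incl _ (fsubsetUl A V)); last first.
  by move=> w _ /negPf->; rewrite mul0r.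
by apply: ler_sum => w _; rewrite ler_piMl ?stochastic_ge0// lern1 leq_b1.
Qed.

Lemma mpow_ge0 k u w : 0 <= mpow V P k u w.
Proof.
elim: k u => [|k IHk] u /=; first exact: ler0n.
by apply: sumr_ge0 => z _; rewrite mulr_ge0 ?stochastic_ge0.
Qed.

Lemma mpow_eq0 k u w : u \notin V -> mpow V P k u w = 0.
Proof.
case: k => [|k] uV /=; first by rewrite (negPf uV) andbF.
by rewrite big1// => z _; rewrite stochastic_eq0 ?mul0r//; left.
Qed.

Lemma mpow_row_sum k u : u \in V -> \sum_(w <- V) mpow V P k u w = 1.
Proof.
move=> uV; elim: k u uV => [|k IHk] u uV /=.
  rewrite -[RHS](sum_delta (fun=> 1) uV); apply: eq_bigr => w _.
  by rewrite uV andbT mulr1.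
rewrite exchange_big/=; have [_ _ /(_ u uV) <-] := stochP.
by apply: eq_big_seq => z zV; rewrite -mulr_sumr IHk ?mulr1.
Qed.

Lemma mpowD j k u w :
  mpow V P (j + k) u w = \sum_(z <- V) mpow V P j u z * mpow V P k z w.
Proof.
elim: j u => [|j IHj] u /=.
  have [uV|uV] := boolP (u \in V); last first.
    by rewrite add0n mpow_eq0// big1// => z _; rewrite andbF mul0r.
  by under eq_bigr do rewrite andbT; rewrite sum_delta.
under [RHS]eq_bigr do rewrite mulr_suml.
rewrite exchange_big/=; apply: eq_bigr => y _.
by rewrite IHj mulr_sumr; apply: eq_bigr => z _; rewrite mulrA.
Qed.

Lemma mpow1 u w : w \in V -> mpow V P 1 u w = P u w.
Proof.
move=> wV; rewrite -(sum_delta (P u) wV) /=; apply: eq_big_seq => z zV.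
by rewrite zV andbT mulrC eq_sym.
Qed.

(** One more step at the start of the walk averages the column entries
    [mpow V P s z v] over [z], so a bound on the whole column survives. *)
Lemma mpow_col_le s s' v c :
  (s <= s')%N -> (forall u, u \in V -> mpow V P s u v <= c) ->
  forall u, u \in V -> mpow V P s' u v <= c.
Proof.
move=> ss' hc u uV; rewrite -(subnK ss') mpowD.
rewrite -[leRHS]mul1r -(mpow_row_sum (s' - s) uV) mulr_suml big_seq.
rewrite [leRHS]big_seq; apply: ler_sum => z zV.
by rewrite ler_wpM2l ?mpow_ge0 ?hc.
Qed.

Lemma mpow_reversible (mu : T -> R) k u w :
  (forall x y, x \in V -> y \in V -> mu x * P x y = mu y * P y x) ->
  u \in V -> w \in V -> mu u * mpow V P k u w = mu w * mpow V P k w u.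
Proof.
move=> bal; elim: k u w => [|k IHk] u w uV wV.
  by rewrite /= uV wV !andbT eq_sym; case: eqVneq => [->|]//; rewrite !mulr0.
rewrite -[in RHS]addn1 mpowD [mpow _ _ k.+1 _ _]/= !mulr_sumr; apply: eq_big_seq => z zV.
by rewrite mpow1// mulrA bal// mulrAC IHk// mulrA.
Qed.

(** After [t] steps the walk is at some vertex with positive probability, and
    by reversibility it can retrace its steps. *)
Lemma mpow_even_diag_gt0 t v :
  reversible V P -> v \in V -> 0 < mpow V P (2 * t) v v.
Proof.
move=> [mu [mu0 bal]] vV.
have := oner_neq0 R; rewrite -(mpow_row_sum t vV) psumr_neq0; last first.
  by move=> z _; exact: mpow_ge0.
case/hasP => z zV /= vz0.
have zv0 : 0 < mpow V P t z v.
  by rewrite -(pmulr_rgt0 _ (mu0 z zV)) -mpow_reversible// mulr_gt0// mu0.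
rewrite mul2n -addnn mpowD; apply: lt_le_trans (mulr_gt0 vz0 zv0) _.
apply: (ler_term_sum (F := fun z => mpow V P t v z * mpow V P t z v)) => //.
by move=> y; rewrite mulr_ge0 ?mpow_ge0.
Qed.

(** * Mixing at even times *)

Lemma even_classP v u :
  reflect (u \in V /\ exists t, mpow V P (2 * t) v u != 0)
    (u \in even_class V P v).
Proof.
by rewrite !inE /=; apply: (iffP andP) => -[uV /asboolP].
Qed.

Lemma even_class_root v : v \in V -> v \in even_class V P v.
Proof.
move=> vV; apply/even_classP; split=> //; exists 0%N.
by rewrite muln0 /= eqxx vV oner_neq0.
Qed.

Lemma even_pi_ge0 v u : 0 <= even_pi V P v u.
Proof. by rewrite /even_pi; case: xgetP => [pi _ []|]. Qed.

Lemma mpow_even_distance s v u w :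
  u \in even_class V P v -> w \in even_class V P v ->
  `|mpow V P s u w - even_pi V P v w| <= 2 * even_distance V P v s.
Proof.
move=> uU wU; rewrite /even_distance mulrA mulfV ?pnatr_eq0// mul1r.
apply: le_trans (le_bigmax_seq 0 u xpredT _ uU erefl).
exact: (ler_term_sum (F := fun w => `|mpow V P s u w - even_pi V P v w|)).
Qed.

(** From the even class of [v] this is the mixing estimate; from any other
    vertex [v] cannot be reached at an even time, because the reversed walk
    would lead from [v] to that vertex. *)
Lemma mpow_even_mixed t v :
  reversible V P -> v \in V ->
  even_distance V P v (2 * t) <= even_pi V P v v ->
  forall u, u \in V -> mpow V P (2 * t) u v <= 3 * even_pi V P v v.
Proof.
move=> [mu [mu0 bal]] vV mixed u uV.
have [uU|uU] := boolP (u \in even_class V P v).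
  have := mpow_even_distance (2 * t) uU (even_class_root vV).
  by move=> /(le_trans (ler_norm _)); lra.
have -> : mpow V P (2 * t) u v = 0.
  have vu0 : mpow V P (2 * t) v u = 0.
    by apply/eqP/negP => /negP vu; case/even_classP: uU; split=> //; exists t.
  have /eqP := mpow_reversible (2 * t) bal uV vV.
  by rewrite vu0 mulr0 mulf_eq0 gt_eqF ?mu0//= => /eqP.
by rewrite mulr_ge0 ?even_pi_ge0.
Qed.

Lemma even_pi_gt0 t v :
  reversible V P -> v \in V ->
  even_distance V P v (2 * t) <= even_pi V P v v -> 0 < even_pi V P v v.
Proof.
move=> revP vV mixed.
have := lt_le_trans (mpow_even_diag_gt0 t revP vV)
  (mpow_even_mixed revP vV mixed vV).
by rewrite pmulr_rgt0.
Qed.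

End StochasticMatrix.

(** A finite infimum excludes the empty set, and a nonempty set of naturals has
    a least element. *)
Lemma even_mixing_time_attained (R : realType) (T : choiceType) (V : {fset T})
    (P : T -> T -> R) (v : T) (eps : R) :
  (even_mixing_time V P v eps < +oo)%E ->
  exists t, [/\ (0 < t)%N, even_distance V P v (2 * t) <= eps
    & even_mixing_time V P v eps = (2 * t)%:R%:E].
Proof.
move=> fin.
pose Q t := (0 < t)%N && (even_distance V P v (2 * t) <= eps).
have exQ : exists t, Q t.
  apply: contrapT => noQ; move: fin; rewrite /even_mixing_time.
  rewrite (_ : [set _ | _ in _] = set0) ?ereal_inf0 ?ltxx//.
  apply/seteqP; split=> // x [t [t0 mixed] _]; apply: noQ; exists t.
  by rewrite /Q t0.
case: (ex_minnP exQ) => t /andP[t0 mixed] tmin; exists t; split=> //.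
apply/eqP; rewrite eq_le; apply/andP; split.
  by apply: ereal_inf_lbound; exists t.
apply: le_ereal_inf_tmp => _ [t' [t'0 mixed'] <-].
by rewrite lee_fin ler_nat leq_mul2l tmin// /Q t'0.
Qed.

(** * Phases *)

Lemma elapsedS f n : elapsed f n.+1 = (elapsed f n + f n.+1)%N.
Proof. by rewrite /elapsed big_nat_recr. Qed.

Lemma elapsed_pred f n : (0 < n)%N -> elapsed f n = (elapsed f n.-1 + f n)%N.
Proof. by case: n => // n _; exact: elapsedS. Qed.

Lemma elapsed_homo f m n : (m <= n)%N -> (elapsed f m <= elapsed f n)%N.
Proof.
move=> /subnK <-; elim: (n - m)%N => // k; rewrite addSn elapsedS => /leq_trans.
by apply; exact: leq_addr.
Qed.

Lemma leq_elapsed f g n : (forall i, (f i <= g i)%N) ->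
  (elapsed f n <= elapsed g n)%N.
Proof. by move=> fg; apply: leq_sum => i _. Qed.

Lemma duration_function_le f g : (forall i, (f i <= g i)%N) ->
  duration_function f -> duration_function g.
Proof.
move=> fg /cvgnyPge df; apply/cvgnyPge => A.
by apply: filterS (df A) => n /leq_trans; apply; exact: leq_elapsed.
Qed.

Lemma phase_gt0 f t : (0 < phase f t)%N.
Proof. by rewrite /phase; case: xgetP => // n _ []. Qed.

Lemma phaseE f n t : (0 < n)%N -> (elapsed f n.-1 <= t < elapsed f n)%N ->
  phase f t = n.
Proof.
move=> n0 tn; apply: xget_unique => // m [m0 tm].
have [mn|nm|//] := ltngtP m n.
- have := @elapsed_homo f m n.-1; lia.
- have := @elapsed_homo f n m.-1; lia.
Qed.

(** * The law of the walk *)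

Section WalkLaw.
Variables (R : realType) (T : choiceType) (V : nat -> {fset T}).
Variables (P : nat -> T -> T -> R) (v : T).
Hypothesis stochP : forall n, (0 < n)%N -> stochastic_on (V n) (P n).

Lemma walk_law_ge0 f t w : 0 <= walk_law f V P v t w.
Proof.
elim: t w => [|t IHt] w /=; first exact: ler0n.
apply: sumr_ge0 => u _; rewrite mulr_ge0//.
by apply: stochastic_ge0; apply/stochP/phase_gt0.
Qed.

Lemma walk_law_sum_le1 f t (A : {fset T}) :
  \sum_(w <- A) walk_law f V P v t w <= 1.
Proof.
elim: t A => [|t IHt] A /=.
  have [vA|vA] := boolP (v \in A).
    rewrite -[leRHS](sum_delta (fun=> 1) vA); apply: ler_sum => w _.
    by rewrite mulr1 eq_sym.
  rewrite big_seq big1 ?ler01// => w wA.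
  by case: eqVneq wA vA => // -> ->.
rewrite exchange_big/=; apply: le_trans (IHt (V (phase f t))).
apply: ler_sum => u _; rewrite -mulr_sumr ler_piMr ?walk_law_ge0//.
by apply: (stochastic_sum_le1 (V := V (phase f t))); apply/stochP/phase_gt0.
Qed.

Lemma return_prob_le1 f t : return_prob f V P v t <= 1.
Proof.
by have := walk_law_sum_le1 f t [fset v]%fset; rewrite big_seq_fset1.
Qed.

(** While the phase stays equal to [n], the walk is homogeneous. *)
Lemma walk_law_run f n a s w : (0 < n)%N -> w \in V n ->
  (forall r, (r < s)%N -> phase f (a + r) = n) ->
  walk_law f V P v (a + s) w =
    \sum_(u <- V n) walk_law f V P v a u * mpow (V n) (P n) s u w.
Proof.
move=> n0; elim: s w => [|s IHs] w wV inn.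
  rewrite addn0 -(sum_delta (walk_law f V P v a) wV); apply: eq_big_seq => u uV.
  by rewrite /= uV andbT mulrC eq_sym.
rewrite addnS [LHS]/= inn//.
under [RHS]eq_bigr do rewrite -addn1 (mpowD (stochP n0)) mulr_sumr.
rewrite exchange_big; apply: eq_big_seq => z zV.
rewrite IHs//; last by move=> r rs; apply/inn/ltnW.
rewrite mulr_suml; apply: eq_bigr => u _.
by rewrite mpow1 ?mulrA.
Qed.

(** * Returns after a long phase *)

(** Prolonging phase [k] beyond time [t] does not decrease the return
    probability at [t], by the less-homesick property; but in the prolonged
    walk the last [t - elapsed g k.-1 >= g k >= s] steps before [t] all follow
    [P k]. *)
Lemma return_prob_after_phase g k s t c :
  lhagg V P v -> duration_function g -> (0 < k)%N -> v \in V k ->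
  (s <= g k)%N -> (0 < t)%N -> (elapsed g k <= t)%N ->
  (forall u, u \in V k -> mpow (V k) (P k) s u v <= c) ->
  return_prob g V P v t <= c.
Proof.
move=> hL dg k0 vV sg t0 kt hc.
pose h (i : nat) : nat := if i == k then (g i + t.+1)%N else g i.
have gh i : (g i <= h i)%N by rewrite /h; case: ifP; rewrite ?leq_addr.
have dh : duration_function h := duration_function_le gh dg.
apply: le_trans (hL g h dg dh _ t t0) _ => [n _|]; first exact: leq_elapsed.
have gk : elapsed g k = (elapsed g k.-1 + g k)%N by exact: elapsed_pred.
have hk1 : elapsed h k.-1 = elapsed g k.-1.
  apply: eq_big_nat => i /andP[_ ik]; rewrite /h ltn_eqF//.
  by rewrite prednK in ik.
have hk : elapsed h k = (elapsed g k + t.+1)%N.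
  by rewrite elapsed_pred// hk1 gk /h eqxx addnA.
set a := elapsed g k.-1 in gk hk1.
rewrite /return_prob -(subnKC (_ : (a <= t)%N)); last by lia.
rewrite (walk_law_run (n := k))//; last first.
  by move=> r rt; apply: phaseE => //; rewrite hk1 hk; lia.
have c0 : 0 <= c by apply: le_trans (hc v vV); apply/mpow_ge0/stochP.
apply: (@le_trans _ _ (\sum_(u <- V k) walk_law h V P v a u * c)).
  rewrite big_seq [leRHS]big_seq; apply: ler_sum => u uV.
  rewrite ler_wpM2l ?walk_law_ge0//.
  by apply: (mpow_col_le (stochP k0)) hc _ uV; lia.
by rewrite -mulr_suml ler_piMl// walk_law_sum_le1.
Qed.

End WalkLaw.

(** Phase [k.+1] has [g k.+1] times, all of them at least [elapsed g k]; the
    first phase is bounded trivially. *)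
Lemma sum_phases_le (R : numDomainType) (r : nat -> R) (g : nat -> nat)
    (c : nat -> R) n :
  (forall t, r t <= 1) ->
  (forall k t, (0 < k)%N -> (elapsed g k <= t)%N -> r t <= c k) ->
  \sum_(0 <= t < elapsed g n.+1) r t <=
    (g 1%N)%:R + \sum_(1 <= k < n.+1) (g k.+1)%:R * c k.
Proof.
move=> r1 rc; elim: n => [|n IHn].
  rewrite /elapsed big_nat1 [X in _ + X]big_geq// addr0.
  apply: le_trans (ler_sum_nat (G := fun=> 1) _) _ => //.
  by rewrite sumr_const_nat subn0.
rewrite elapsedS big_nat_recr//= addrA.
rewrite (big_cat_nat (leq0n _) (leq_addr _ _))/= lerD//.
apply: le_trans (ler_sum_nat (G := fun=> c n.+1) _) _.
  by move=> t /andP[+ _]; exact: rc.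
by rewrite sumr_const_nat addKn mulr_natl.
Qed.

Lemma nneseries_term_lty (R : realType) (u : nat -> \bar R) m n :
  (forall k, (m <= k)%N -> (0 <= u k)%E) -> (m <= n)%N ->
  (\sum_(m <= k <oo) u k < +oo)%E -> (u n < +oo)%E.
Proof.
move=> u0 mn; apply: le_lt_trans.
apply: le_trans (nneseries_lim_ge (P := xpredT) n.+1 _) => [|k mk _]; last exact: u0.
rewrite big_nat_recr//= leeDr//.
by rewrite big_nat; apply: sume_ge0 => k /andP[mk _]; exact: u0.
Qed.

Theorem lemma3p4 (R : realType) (T : choiceType) (d : nat -> nat)
    (V : nat -> {fset T}) (E : nat -> rel T) (P : nat -> T -> T -> R) (v : T)
    (hD : rwogg d V E P)
    (hv : v \in V 1%N)
    (hL : lhagg V P v)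
    (hP : forall n, (0 < n)%N ->
       [/\ irreducible (V n) (P n), reversible (V n) (P n)
         & has_period (V n) (P n) 2]) :
  let p (n : nat) : R := even_pi (V n) (P n) v v in
  let t (n : nat) : \bar R := even_mixing_time (V n) (P n) v (p n) in
  (maxe (d 1%N)%:R%:E (t 1%N)
     + \sum_(2 <= n <oo) (maxe (d n)%:R%:E (t n) * (p n.-1)%:E) < +oo)%E ->
  transient d V P v.
Proof.
move=> p t fin.
have [dd [_ subV _ _] walkP] := hD.
have stochP n (n0 : (0 < n)%N) : stochastic_on (V n) (P n) by case: (walkP n n0).
have revP n (n0 : (0 < n)%N) : reversible (V n) (P n) by case: (hP n n0).
have vV n (n0 : (0 < n)%N) : v \in V n.
  case: n n0 => // n _; elim: n => // n; exact/fsubsetP/subV.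
pose a n := (maxe (d n)%:R%:E (t n) * (p n.-1)%:E)%E.
have p0 n : 0 <= p n by exact: even_pi_ge0.
have max0 n : (0 <= maxe (d n)%:R%:E (t n))%E.
  by rewrite le_max lee_fin ler0n.
have a0 n : (0 <= a n)%E by rewrite mule_ge0// lee_fin.
have S0 : (0 <= \sum_(2 <= n <oo) a n)%E by apply: nneseries_ge0.
have maxy : (maxe (d 1%N)%:R%:E (t 1%N) < +oo)%E.
  by apply: le_lt_trans fin; rewrite leeDl.
have Sy : (\sum_(2 <= n <oo) a n < +oo)%E.
  by apply: le_lt_trans fin; rewrite leeDr.
pose Q n m := [/\ (0 < m)%N, even_distance (V n) (P n) v (2 * m) <= p n
  & t n = (2 * m)%:R%:E].
(* The mixing times are finite, by induction: in the series [t n.+2] has the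
   coefficient [p n.+1], which is positive because phase [n.+1] does mix. *)
have exQ n : exists m, Q n.+1 m.
  elim: n => [|n [m [_ mixed _]]]; apply: even_mixing_time_attained.
    by apply: le_lt_trans maxy; rewrite le_max lexx orbT.
  have pn : 0 < p n.+1.
    exact: (even_pi_gt0 (stochP n.+1 isT) (revP n.+1 isT) (vV n.+1 isT) mixed).
  rewrite -/(p n.+2) -/(t n.+2).
  have /(_ n.+2 isT Sy) := nneseries_term_lty (m := 2) (fun i _ => a0 i).
  by rewrite /a; case: (t n.+2) => [r| |]; rewrite ?ltry// maxey gt0_mulye ?lte_fin.
have [m Qm] := choice exQ.
pose g n := maxn (d n) (2 * m n.-1).
have gE n : (maxe (d n.+1)%:R%:E (t n.+1) = (g n.+1)%:R%:E)%E.
  have [_ _ ->] := Qm n; rewrite /g -EFin_max; congr EFin.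
  by rewrite natr_max.
have dg i : (d i <= g i)%N by exact: leq_maxl.
have durg : duration_function g := duration_function_le dg dd.
have g1 : (0 < elapsed g 1)%N.
  by rewrite /elapsed big_nat1 /g leq_max muln_gt0; case: (Qm 0%N) => -> _ _; rewrite orbT.
pose r s := return_prob g V P v s.
have r_le k s : (0 < k)%N -> (elapsed g k <= s)%N -> r s <= 3 * p k.
  case: k => // k _ ks; have [_ mixed _] := Qm k.
  apply: (return_prob_after_phase stochP hL durg (k := k.+1) (s := (2 * m k)%N)) => //.
  - exact: vV.
  - exact: leq_maxr.
  - by apply: leq_trans g1 (leq_trans (elapsed_homo g _) ks).
  - exact: (mpow_even_mixed (stochP k.+1 isT) (revP k.+1 isT) (vV k.+1 isT) mixed).
have [S SE] : exists S : R, (\sum_(2 <= n <oo) a n)%E = S%:E.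
  by exists (fine (\sum_(2 <= n <oo) a n)%E); rewrite fineK// ge0_fin_numE.
have phases n : \sum_(1 <= k < n.+1) (g k.+1)%:R * (3 * p k) <= 3 * S.
  under eq_bigr do rewrite mulrCA.
  rewrite -mulr_sumr ler_pM2l// -lee_fin -SE -sumEFin.
  have := nneseries_lim_ge (u_ := a) (P := xpredT) (m := 2) n.+2 (fun i _ _ => a0 i).
  rewrite big_add1/=; apply: le_trans.
  by rewrite le_eqVlt; apply/orP; left; apply/eqP/eq_bigr => k _; rewrite /a gE.
have bound n : \sum_(1 <= s < n) return_prob d V P v s <= (g 1%N)%:R + 3 * S.
  have [N _ /(_ N (leqnn N)) nN] := (cvgnyPge (elapsed g)).1 durg n.
  apply: (@le_trans _ _ (\sum_(0 <= s < elapsed g N.+1) r s)); last first.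
    apply: le_trans (sum_phases_le _ _ r_le) _; last by rewrite lerD2l.
    by move=> s; exact: return_prob_le1.
  have r0 s : 0 <= r s by exact: walk_law_ge0.
  have nN1 : (n <= elapsed g N.+1)%N := leq_trans nN (elapsed_homo g (leqnSn N)).
  apply: (@le_trans _ _ (\sum_(1 <= s < n) r s)).
    apply: ler_sum_nat => s /andP[s0 _]; apply: hL => // i _; exact: leq_elapsed.
  case: n nN1 {nN} => [|n] nN1; first by rewrite big_geq// sumr_ge0.
  rewrite (big_cat_nat (leq0n _) nN1)/= [in leRHS]big_nat_recl// big_add1/=.
  by rewrite addrAC lerDr addr_ge0// sumr_ge0.
rewrite /transient /recurrent => rec.
suff : (\sum_(1 <= s <oo) (return_prob d V P v s)%:E <= ((g 1%N)%:R + 3 * S)%:E)%E.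
  by rewrite rec leye_eq.
apply: lime_le.
  by apply: is_cvg_nneseries => n _ _; rewrite lee_fin; exact: walk_law_ge0.
by apply: nearW => n; rewrite sumEFin lee_fin.
Qed.
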